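(* Let $H$ be a fully commutative heap of type $\widetilde{G}_2$ with more than four $t$-elements. Then the interval of $H$ between its extremal (i.e. smallest and largest) $t$-elements is (the heap of) a factor of the word $(tsutu)^N$ for a certain integer $N>0$.
   Context: The Coxeter graph $\widetilde{G}_2$ has vertices $s,t,u$ with $m_{st}=3$, $m_{tu}=6$, $m_{su}=2$. An element of the Coxeter group is fully commutative (FC) if any of its reduced expressions can be obtained from any other one using only commutation relations. For a word $\mathbf w=x_1\cdots x_l$ in the generators, $\operatorname{Heap}(\mathbf w)$ is the poset on $\{1,\dots,l\}$ with order the transitive closure of $i\prec j$ for $i<j$ and $x_i,x_j$ equal or adjacent in the Coxeter graph, each $i$ being labeled $x_i$; heaps are considered up to label-preserving isomorphism. A heap is FC if it is $\operatorname{Heap}(\mathbf w)$ for a reduced word $\mathbf w$ of an FC element. A $t$-element is an element labeled $t$; the $t$-elements form a chain. A factor of a word is a contiguous subword. The interval between $a\le b$ is $\{x: a\le x\le b\}$ with the induced order and labels. *)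

(* Defs.v *)
From HB Require Import structures.
From mathcomp Require Import all_boot all_order.
From Stdlib Require Import Relation_Operators.

Set Implicit Arguments.
Unset Strict Implicit.
Unset Printing Implicit Defensive.

Section Coxeter.

(* [m] is the Coxeter matrix; the entry 0 stands for infinity. *)
Variables (S : eqType) (m : S -> S -> nat).
Implicit Types v w : seq S.

Definition cox_relator (x y : S) : seq S := flatten (nseq (m x y) [:: x; y]).

Inductive cox_step : seq S -> seq S -> Prop :=
  CoxStep p x y q : cox_step (p ++ cox_relator x y ++ q) (p ++ q).

(* Words equal in the Coxeter group <S | (xy)^(m x y) = 1>.  Since m x x = 1
   makes every generator an involution, the group is also the quotient of the
   monoid of words by the congruence that these relators generate. *)
Definition cox_eq : seq S -> seq S -> Prop :=
  clos_refl_sym_trans (seq S) cox_step.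

Definition reduced w : Prop := forall v, cox_eq v w -> size w <= size v.

Definition reduced_expr v w : Prop := cox_eq v w /\ reduced v.

Inductive comm_step : seq S -> seq S -> Prop :=
  CommStep p x y q :
    m x y = 2 -> comm_step (p ++ [:: x; y] ++ q) (p ++ [:: y; x] ++ q).

Definition comm_eq : seq S -> seq S -> Prop :=
  clos_refl_sym_trans (seq S) comm_step.

(* The group element represented by the word w is fully commutative. *)
Definition fully_commutative w : Prop :=
  forall v1 v2, reduced_expr v1 w -> reduced_expr v2 w -> comm_eq v1 v2.

Definition cox_adj (x y : S) : bool := (x != y) && (m x y != 2).

End Coxeter.

Arguments fully_commutative {S} m w.
Arguments reduced {S} m w.

(* The positions of w, from 0 instead of 1.  An alias, as 'I_n already carries
   the usual order; the argument m lets the order instance depend on m. *)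
Definition heap (S : eqType) (m : S -> S -> nat) (w : seq S) : Type :=
  'I_(size w).

Fact heap_display : Order.disp_t. Proof. exact: Order.Disp tt tt. Qed.

Section Heap.

Variables (S : eqType) (m : S -> S -> nat) (w : seq S).
Local Notation heap := (heap m w).

HB.instance Definition _ := Finite.copy heap 'I_(size w).

Definition heap_label (i : heap) : S := tnth (in_tuple w) i.

Definition heap_edge : rel heap := fun i j =>
  (nat_of_ord i < nat_of_ord j)%N
  && ((heap_label i == heap_label j) || cox_adj m (heap_label i) (heap_label j)).

Definition heap_le : rel heap := connect heap_edge.

Lemma heap_le_leq (i j : heap) :
  heap_le i j -> (nat_of_ord i <= nat_of_ord j)%N.
Proof.
case/connectP=> p; elim: p i => [|k p IHp] i /= => [_ -> //|].
case/andP=> /andP[/ltnW le_ik _] kp def_j.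
exact: leq_trans le_ik (IHp _ kp def_j).
Qed.

Lemma heap_le_refl : reflexive heap_le.
Proof. exact: connect0. Qed.

Lemma heap_le_anti : antisymmetric heap_le.
Proof.
move=> i j /andP[/heap_le_leq le_ij /heap_le_leq le_ji].
by apply/val_inj/eqP; rewrite eqn_leq le_ij le_ji.
Qed.

Lemma heap_le_trans : transitive heap_le.
Proof. exact: connect_trans. Qed.

HB.instance Definition _ := Order.Le_isPOrder.Build heap_display heap
  heap_le_refl heap_le_anti heap_le_trans.

End Heap.

Arguments heap_label {S} m w i.

Definition lposet_iso (S : Type) d1 d2 (T1 : porderType d1) (T2 : porderType d2)
    (lab1 : T1 -> S) (lab2 : T2 -> S) : Prop :=
  exists f : T1 -> T2,
    [/\ bijective f, {mono f : x y / (x <= y)%O} & forall x, lab2 (f x) = lab1 x].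

Definition fc_heap (S : eqType) (m : S -> S -> nat) d (H : finPOrderType d)
    (lab : H -> S) : Prop :=
  exists w : seq S, [/\ reduced m w, fully_commutative m w
    & lposet_iso lab (heap_label m w)].

Section Interval.

Variables (d : Order.disp_t) (H : finPOrderType d) (a b : H).

Definition poset_interval : Type := {x : H | (a <= x <= b)%O}.

HB.instance Definition _ := SubFinite.on poset_interval.
HB.instance Definition _ :=
  [SubChoice_isSubPOrder of poset_interval by <: with d].

Definition interval_label (S : Type) (lab : H -> S) (x : poset_interval) : S :=
  lab (val x).

Definition least_labeled (S : eqType) (lab : H -> S) (c : S) : Prop :=
  lab a = c /\ forall x, lab x = c -> (a <= x)%O.

Definition greatest_labeled (S : eqType) (lab : H -> S) (c : S) : Prop :=
  lab b = c /\ forall x, lab x = c -> (x <= b)%O.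

End Interval.

Inductive gen := Gs | Gt | Gu.

Definition gen_code (x : gen) : nat :=
  match x with Gs => 0 | Gt => 1 | Gu => 2 end.

Definition gen_decode (n : nat) : gen :=
  match n with 0 => Gs | 1 => Gt | _ => Gu end.

Lemma gen_codeK : cancel gen_code gen_decode. Proof. by case. Qed.

HB.instance Definition _ := Equality.copy gen (can_type gen_codeK).

(* The Coxeter matrix of affine G_2. *)
Definition G2t (x y : gen) : nat :=
  match x, y with
  | Gs, Gs | Gt, Gt | Gu, Gu => 1
  | Gs, Gt | Gt, Gs => 3
  | Gt, Gu | Gu, Gt => 6
  | Gs, Gu | Gu, Gs => 2
  end.

Definition word_pow (S : Type) (v : seq S) (N : nat) : seq S :=
  flatten (nseq N v).

(* Main.v *)
Require Import Defs.
From mathcomp Require Import all_boot all_order zify.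
From Stdlib Require Import Relation_Operators.

Set Implicit Arguments.
Unset Strict Implicit.
Unset Printing Implicit Defensive.

(** Two facts restrict a reduced word of a fully commutative element.  It has
    no factor [xx], and no factor that is one side of a braid relation of
    length at least 3: exchanging the two sides of the relation would give
    another reduced word, with a different projection onto the two letters of
    the relation, whereas commutations preserve this projection
    (lemma [braid_forbidden]).  Words that commute into a word with such a
    factor are excluded as well.

    Since [s] and [u] commute, the word may be changed, without changing its
    heap (lemma [comm_eq_heap_iso]), so that [us] is not a factor. Two
    consecutive letters [t] then enclose one of [s], [u], [su], not the empty
    word because of [tt]; the first is impossible because of the braid [tst],
    so every gap contains [u] (lemma [gaps_parse]). Two consecutive gaps [su]
    produce [sutsu], which commutes to a word containing the braid [sts]. Two
    consecutive gaps [u] give [tutut]; as soon as there is a third gap next to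
    them, its [u] completes this to one of the braids [ututut], [tututu], up
    to moving an [s] out of the way (lemma [repeated_gap_forbidden]). So with
    three gaps at least, the gaps [u] and [su] alternate, which says that the
    part of the word between its extremal letters [t] is a factor of a power
    of [tsutu].

    Finally this part of the word is the interval of the heap: all generators
    are equal or adjacent to [t], so a [t]-element is comparable with every
    element, in the order of positions (lemma [t_comparable]), while the heap
    of a factor embeds in the heap of the word (lemma [heap_shift_mono]). *)

(** * Forbidden factors in reduced words of fully commutative elements *)

Section Words.

Variables (S : eqType) (m : S -> S -> nat).
Hypothesis m_diag : forall x, m x x = 1.
Hypothesis m_sym : forall x y, m x y = m y x.
Implicit Types (x y : S) (p q u v w : seq S).

Lemma cox_eq_refl w : cox_eq m w w.
Proof. exact: rst_refl. Qed.

Lemma cox_eq_sym v w : cox_eq m v w -> cox_eq m w v.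
Proof. exact: rst_sym. Qed.

Lemma cox_eq_trans v u w : cox_eq m u v -> cox_eq m v w -> cox_eq m u w.
Proof. exact: rst_trans. Qed.

Lemma comm_eq_sym v w : comm_eq m v w -> comm_eq m w v.
Proof. exact: rst_sym. Qed.

Lemma comm_eq_trans v u w : comm_eq m u v -> comm_eq m v w -> comm_eq m u w.
Proof. exact: rst_trans. Qed.

Lemma cox_eq_context p q v w :
  cox_eq m v w -> cox_eq m (p ++ v ++ q) (p ++ w ++ q).
Proof.
elim=> [_ _ [p' x y q'] | v' | v' w' _ | u v' w' _ uv _ vw].
- have assoc z : p ++ (p' ++ z ++ q') ++ q = (p ++ p') ++ z ++ (q' ++ q).
    by rewrite -!catA.
  (* The empty word stands where the relator was erased. *)
  rewrite assoc [X in cox_eq m _ X](assoc [::]).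
  by apply: rst_step; apply: CoxStep.
- exact: cox_eq_refl.
- exact: cox_eq_sym.
- exact: cox_eq_trans uv vw.
Qed.

Lemma comm_eq_context p q v w :
  comm_eq m v w -> comm_eq m (p ++ v ++ q) (p ++ w ++ q).
Proof.
elim=> [_ _ [p' x y q' mxy] | v' | v' w' _ | u v' w' _ uv _ vw].
- have assoc z : p ++ (p' ++ z ++ q') ++ q = (p ++ p') ++ z ++ (q' ++ q).
    by rewrite -!catA.
  by rewrite !assoc; apply: rst_step; constructor.
- exact: rst_refl.
- exact: comm_eq_sym.
- exact: comm_eq_trans uv vw.
Qed.

Lemma cox_eq_square p q x : cox_eq m (p ++ [:: x; x] ++ q) (p ++ q).
Proof.
by apply: rst_step; move: (CoxStep m p x x q); rewrite /cox_relator m_diag.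
Qed.

Lemma cox_eq_rev_cat w : cox_eq m (rev w ++ w) [::].
Proof.
elim: w => [|x w IHw] /=; first exact: cox_eq_refl.
rewrite rev_cons cat_rcons; apply: cox_eq_trans IHw.
exact: (cox_eq_square (rev w) w x).
Qed.

(** Since [c] is undone by its reverse, a relator [b c^-1] amounts to the
    rewriting rule [b = c]; braid and commutation relations arise this way. *)
Lemma cox_eq_of_relator x y b c :
  cox_relator m x y = b ++ rev c -> cox_eq m b c.
Proof.
move=> def_r; apply: (@cox_eq_trans (b ++ rev c ++ c)).
  apply: cox_eq_sym; have := cox_eq_context b [::] (cox_eq_rev_cat c).
  by rewrite !cats0.
rewrite catA -def_r; apply: rst_step.
exact: (CoxStep m [::] x y c).
Qed.

Lemma comm_eq_size v w : comm_eq m v w -> size v = size w.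
Proof.
elim=> [_ _ [p x y q _] | // | v' w' _ -> | u v' w' _ -> _ ->] //.
by rewrite !size_cat.
Qed.

Lemma comm_eq_cox_eq v w : comm_eq m v w -> cox_eq m v w.
Proof.
elim=> [_ _ [p x y q mxy] | v' | v' w' _ | u v' w' _ uv _ vw].
- apply: cox_eq_context; apply: (@cox_eq_of_relator x y).
  by rewrite /cox_relator mxy.
- exact: cox_eq_refl.
- exact: cox_eq_sym.
- exact: cox_eq_trans uv vw.
Qed.

(** The occurrences of two letters that do not commute never cross, so the
    projection onto these two letters is an invariant of commutation classes. *)
Lemma comm_eq_filter x y v w :
  m x y != 2 -> comm_eq m v w ->
  filter (pred2 x y) v = filter (pred2 x y) w.
Proof.
move=> mxy; elim=> [_ _ [p a b q mab] | // | v' w' _ -> | u v' w' _ -> _ ->] //.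
rewrite !filter_cat; congr (_ ++ (_ ++ _)) => /=.
case: (@pred2P _ _ a x a y) => // xy_a; case: (@pred2P _ _ b x b y) => // xy_b.
case: xy_a xy_b mab => -> [] ->; rewrite ?m_diag // => mab.
  by rewrite mab in mxy.
by rewrite m_sym mab in mxy.
Qed.

Definition fc_word w : Prop := reduced m w /\ fully_commutative m w.

Lemma fc_word_comm_eq v w : comm_eq m v w -> fc_word w -> fc_word v.
Proof.
move=> vw [red_w fc_w]; have cox_vw := comm_eq_cox_eq vw; split=> [z zv | v1 v2].
  by rewrite (comm_eq_size vw); apply: red_w; apply: cox_eq_trans cox_vw.
case=> v1v red1 [v2v red2].
by apply: fc_w; split=> //; apply: cox_eq_trans cox_vw.
Qed.

(** Quantifying over contexts, rather than asking that [f] itself fail to be an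
    [fc_word], makes heredity under [infix] immediate. *)
Definition forbidden (f : seq S) : Prop := forall p q, ~ fc_word (p ++ f ++ q).

Lemma forbidden_infix f g : infix f g -> forbidden f -> forbidden g.
Proof.
case/infixP=> [p' [q' ->]] bad_f p q fc_g; apply: (bad_f (p ++ p') (q' ++ q)).
by rewrite -!catA in fc_g *.
Qed.

Lemma forbidden_comm_eq f g : comm_eq m f g -> forbidden g -> forbidden f.
Proof.
move=> fg bad_g p q fc_f; apply: (bad_g p q); apply: fc_word_comm_eq fc_f.
by apply: comm_eq_context; apply: comm_eq_sym.
Qed.

Lemma square_forbidden x : forbidden [:: x; x].
Proof.
move=> p q [/(_ _ (cox_eq_sym (cox_eq_square p q x)))].
by rewrite !size_cat /= leq_add2l ltnNge leqnSn.
Qed.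

(** Both sides [b] and [c] of a braid relation would give reduced expressions
    of the same element, although they differ in their projection onto the
    two letters involved. *)
Lemma braid_forbidden x y b c :
    m x y != 2 -> cox_relator m x y = b ++ rev c -> size b = size c -> b != c ->
  forbidden b.
Proof.
move=> mxy def_r eq_size b_neq_c p q [red_b fc_b].
have cb: cox_eq m (p ++ c ++ q) (p ++ b ++ q).
  by apply: cox_eq_context; apply: cox_eq_sym; apply: cox_eq_of_relator def_r.
have /(comm_eq_filter mxy) : comm_eq m (p ++ b ++ q) (p ++ c ++ q).
  apply: fc_b; split=> //; first exact: cox_eq_refl.
  move=> v vc; rewrite !size_cat -eq_size -!size_cat.
  by apply: red_b; apply: cox_eq_trans cb.
have: all (pred2 x y) (b ++ rev c).
  rewrite -def_r /cox_relator; elim: (m x y) => //= n ->.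
  by rewrite !eqxx orbT.
rewrite all_cat all_rev => /andP[/all_filterP b_xy /all_filterP c_xy].
rewrite !filter_cat b_xy c_xy => /eqP; rewrite eqseq_cat // eqxx /=.
by rewrite eqseq_cat // (negPf b_neq_c).
Qed.

End Words.
Arguments fc_word {S} m w.
Arguments forbidden {S} m f.

(** * Commutations do not change the heap *)

Section Isomorphism.

Variables (S : Type).

Lemma lposet_iso_refl d (T : porderType d) (lab : T -> S) : lposet_iso lab lab.
Proof. by exists id; split=> //; exists id. Qed.

Lemma lposet_iso_sym d1 d2 (T1 : porderType d1) (T2 : porderType d2)
    (lab1 : T1 -> S) (lab2 : T2 -> S) :
  lposet_iso lab1 lab2 -> lposet_iso lab2 lab1.
Proof.
case=> f [[g fK gK] f_mono f_lab]; exists g; split=> [|x y|x].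
- by exists f.
- by rewrite -f_mono !gK.
- by rewrite -f_lab gK.
Qed.

Lemma lposet_iso_trans d1 d2 d3 (T1 : porderType d1) (T2 : porderType d2)
    (T3 : porderType d3) (lab1 : T1 -> S) (lab2 : T2 -> S) (lab3 : T3 -> S) :
  lposet_iso lab1 lab2 -> lposet_iso lab2 lab3 -> lposet_iso lab1 lab3.
Proof.
case=> f [f_bij f_mono f_lab] [g [g_bij g_mono g_lab]].
exists (g \o f); split=> [|x y|x] /=; first exact: bij_comp.
  by rewrite g_mono f_mono.
by rewrite g_lab f_lab.
Qed.

End Isomorphism.

Lemma connect_homo (T1 T2 : finType) (e1 : rel T1) (e2 : rel T2) (f : T1 -> T2) :
  {homo f : x y / e1 x y >-> e2 x y} ->
  {homo f : x y / connect e1 x y >-> connect e2 x y}.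
Proof.
move=> f_homo x y /connectP[p]; elim: p x => [|z p IHp] x /= => [_ -> // | ].
case/andP=> xz zp y_last; apply: connect_trans (IHp z zp y_last).
exact/connect1/f_homo.
Qed.

Section Heaps.

Variables (S : eqType) (m : S -> S -> nat).
Hypothesis m_diag : forall x, m x x = 1.
Hypothesis m_sym : forall x y, m x y = m y x.
Implicit Types (x y : S) (p q v w : seq S).

Lemma heap_label_nth x0 w (i : heap m w) : heap_label m w i = nth x0 w i.
Proof. by rewrite /heap_label (tnth_nth x0). Qed.

Definition related x y : bool := (x == y) || cox_adj m x y.

Lemma heap_edgeE x0 w (i j : heap m w) :
  heap_edge i j = (i < j) && related (nth x0 w i) (nth x0 w j).
Proof. by rewrite /heap_edge !(heap_label_nth x0). Qed.

Definition swap_next (n i : nat) : nat :=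
  if i == n then n.+1 else if i == n.+1 then n else i.

Lemma swap_nextK n : involutive (swap_next n).
Proof.
move=> i; rewrite /swap_next.
case: (i =P n) => [-> | ]; first by rewrite eqn_leq ltnn eqxx.
case: (i =P n.+1) => [-> | ]; first by rewrite eqxx.
by move=> /eqP/negPf-> /eqP/negPf->.
Qed.

Lemma swap_next_lt n i j :
  i < j -> ~~ ((i == n) && (j == n.+1)) -> swap_next n i < swap_next n j.
Proof.
rewrite /swap_next => lt_ij not_n.
by do 4?[case: (_ =P _) => ?]; subst; lia.
Qed.

Lemma swap_next_bound p x y q i :
  i < size (p ++ [:: x; y] ++ q) ->
  swap_next (size p) i < size (p ++ [:: y; x] ++ q).
Proof.
rewrite !size_cat /= /swap_next => lt_i.
by case: (i =P _) => _; last case: (i =P _) => _; lia.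
Qed.

Definition heap_swap p x y q (i : heap m (p ++ [:: x; y] ++ q)) :
    heap m (p ++ [:: y; x] ++ q) :=
  Ordinal (swap_next_bound (ltn_ord i)).

Lemma nth_swap_next x0 p x y q i :
  nth x0 (p ++ [:: y; x] ++ q) (swap_next (size p) i) =
  nth x0 (p ++ [:: x; y] ++ q) i.
Proof.
rewrite /swap_next !nth_cat.
have [lt_ip | le_pi] := ltnP i (size p).
  have [-> ->] : (i == size p) = false /\ (i == (size p).+1) = false by lia.
  by rewrite lt_ip.
rewrite -(subnKC le_pi); move: (i - size p) => k; rewrite addKn.
case: k => [|[|k]] /=; rewrite ?addn0 ?addn1 ?eqxx.
- by rewrite ltnNge leqnSn subSnn.
- by rewrite eqn_leq ltnn /= ltnn subnn.
set i' := size p + k.+2.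
have [-> ->] : (i' == size p) = false /\ (i' == (size p).+1) = false by lia.
by rewrite ifF ?addKn //; lia.
Qed.

Lemma comm_unrelated x y : m x y = 2 -> related x y = false.
Proof.
move=> mxy; rewrite /related /cox_adj mxy andbF orbF; apply/eqP=> def_x.
by move: mxy; rewrite def_x m_diag.
Qed.

(** Only the order of the two swapped positions is reversed, and these carry
    commuting letters, hence are not joined by an edge. *)
Lemma heap_swap_edge p x y q : m x y = 2 ->
  {homo @heap_swap p x y q : i j / heap_edge i j >-> heap_edge i j}.
Proof.
move=> mxy i j; rewrite !(heap_edgeE x) /= !nth_swap_next.
case/andP=> lt_ij rel_ij; rewrite rel_ij andbT.
apply: swap_next_lt lt_ij _; apply: contraTN rel_ij => /andP[/eqP-> /eqP->].
by rewrite !nth_cat ltnn subnn ltnNge leqnSn subSnn /= comm_unrelated.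
Qed.

Lemma comm_step_heap_iso v w :
  comm_step m v w -> lposet_iso (heap_label m v) (heap_label m w).
Proof.
case=> p x y q mxy; have myx: m y x = 2 by rewrite m_sym.
have swapK a b : cancel (@heap_swap p a b q) (@heap_swap p b a q).
  by move=> i; apply/val_inj/swap_nextK.
exists (@heap_swap p x y q); split=> [|i j|i].
- by exists (@heap_swap p y x q).
- apply/idP/idP; last exact/connect_homo/heap_swap_edge.
  by move/(connect_homo (heap_swap_edge (q := q) myx)); rewrite !swapK.
by rewrite !(heap_label_nth x) /= nth_swap_next.
Qed.

Lemma comm_eq_heap_iso v w :
  comm_eq m v w -> lposet_iso (heap_label m v) (heap_label m w).
Proof.
elim=> [v' w' | v' | v' w' _ | u v' w' _ uv _ vw].
- exact: comm_step_heap_iso.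
- exact: lposet_iso_refl.
- exact: lposet_iso_sym.
- exact: lposet_iso_trans uv vw.
Qed.

(** * Factors of a word and intervals of its heap *)

Lemma heap_shift_bound p v q i :
  i < size v -> size p + i < size (p ++ v ++ q).
Proof. by rewrite !size_cat; lia. Qed.

Definition heap_shift p v q (i : heap m v) : heap m (p ++ v ++ q) :=
  Ordinal (heap_shift_bound p q (ltn_ord i)).

Lemma nth_shift x0 p v q i :
  i < size v -> nth x0 (p ++ v ++ q) (size p + i) = nth x0 v i.
Proof.
by move=> lt_i; rewrite nth_cat ltnNge leq_addr /= addKn nth_cat lt_i.
Qed.

Lemma heap_label_shift p v q (i : heap m v) :
  heap_label m (p ++ v ++ q) (heap_shift p q i) = heap_label m v i.
Proof.
have x0 := heap_label m v i.
by rewrite !(heap_label_nth x0) nth_shift ?ltn_ord.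
Qed.

Lemma heap_shift_edge p v q (i j : heap m v) :
  heap_edge (heap_shift p q i) (heap_shift p q j) = heap_edge i j.
Proof. by rewrite /heap_edge !heap_label_shift /= ltn_add2l. Qed.

Lemma heap_shift_onto p v q (k : heap m (p ++ v ++ q)) :
  size p <= k -> k < size p + size v -> exists i : heap m v, k = heap_shift p q i.
Proof.
move=> le_pk lt_k; have lt_i: k - size p < size v by lia.
by exists (Ordinal lt_i); apply: val_inj; rewrite /= subnKC.
Qed.

(** A chain of the heap of [p ++ v ++ q] between two positions of [v] cannot
    leave [v], because positions increase along it. *)
Lemma heap_shift_mono p v q :
  {mono @heap_shift p v q : i j / (i <= j)%O}.
Proof.
move=> i j; apply/idP/idP; last first.
  by apply: connect_homo => k l; rewrite heap_shift_edge.
case/connectP=> c; elim: c i => [|k c IHc] i /=.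
  move=> _ /(congr1 val)/addnI eq_ij; rewrite (_ : i = j) ?heap_le_refl //.
  exact: val_inj.
case/andP=> ik kc j_last; have lt_ik: heap_shift p q i < k by case/andP: ik.
have le_kj: k <= heap_shift p q j.
  by apply: heap_le_leq; apply/connectP; exists c.
have [||i' def_k] := @heap_shift_onto p v q k.
- by apply: leq_trans (ltnW lt_ik); exact: leq_addr.
- by apply: leq_ltn_trans le_kj _; rewrite ltn_add2l ltn_ord.
rewrite def_k heap_shift_edge in ik kc j_last.
exact: heap_le_trans (connect1 ik) (IHc _ kc j_last).
Qed.

Lemma card_heap_label c w :
  #|[set i : heap m w | heap_label m w i == c]| = count_mem c w.
Proof.
rewrite cardsE -sum1_count big_tnth sum1_card; exact: eq_card.
Qed.

End Heaps.

Lemma lposet_iso_card (S : eqType) d1 d2 (T1 : finPOrderType d1)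
    (T2 : finPOrderType d2) (lab1 : T1 -> S) (lab2 : T2 -> S) c :
  lposet_iso lab1 lab2 ->
  #|[set x | lab1 x == c]| = #|[set y | lab2 y == c]|.
Proof.
case=> f [f_bij _ f_lab]; rewrite -(on_card_preimset (f := f)); last first.
  exact: onW_bij.
by apply: eq_card => x; rewrite !inE f_lab.
Qed.

(** Identifies an interval by exhibiting it as the image of an order
    embedding, which avoids defining the inverse map. *)
Lemma lposet_iso_interval (S : Type) d1 d2 (T : finPOrderType d1)
    (H : finPOrderType d2) (labT : T -> S) (lab : H -> S) (g : T -> H) (a b : H) :
    {mono g : x y / (x <= y)%O} -> (forall x, lab (g x) = labT x) ->
    (forall y, (a <= y <= b)%O <-> exists x, y = g x) ->
  lposet_iso (interval_label (a := a) (b := b) lab) labT.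
Proof.
move=> g_mono g_lab g_img; apply: lposet_iso_sym.
have in_ab x : (a <= g x <= b)%O by apply/g_img; exists x.
pose h x : poset_interval a b := exist _ (g x) (in_ab x).
have h_inj: injective h.
  by move=> x y /(congr1 val) /=; apply: Order.POrderTheory.inc_inj.
have ex_inv (y : poset_interval a b) : exists x, h x == y.
  have /g_img[x def_y] := valP y; exists x.
  by apply/eqP/val_inj; rewrite /= -def_y.
exists h; split=> [|x y|x]; last exact: g_lab.
  exists (fun y => xchoose (ex_inv y)) => [x|y].
    by apply: h_inj; apply/eqP; apply: (xchooseP (ex_inv (h x))).
  exact/eqP/(xchooseP (ex_inv y)).
exact: g_mono.
Qed.

(** * Forbidden factors in type affine G2 *)

Lemma G2t_diag x : G2t x x = 1. Proof. by case: x. Qed.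

Lemma G2t_sym x y : G2t x y = G2t y x. Proof. by case: x; case: y. Qed.

(** Moving every [s] to the left of the letters [u] next to it leaves a single
    word for each possible content of the gap between two letters [t]. *)
Lemma su_normal_form w :
  exists v, comm_eq G2t w v /\ ~~ infix [:: Gu; Gs] v.
Proof.
have insert_u v : ~~ infix [:: Gu; Gs] v ->
    exists2 v', comm_eq G2t (Gu :: v) v' & ~~ infix [:: Gu; Gs] v'.
  elim: v => [|[] v IHv] nf_v; try by eexists; [exact: rst_refl|].
  case: (IHv nf_v) => v' vv' nf_v'; exists (Gs :: v') => //.
  have := comm_eq_context [:: Gs] [::] vv'; rewrite /= !cats0.
  apply: comm_eq_trans; apply: rst_step.
  exact: (CommStep [::] v (x := Gu) (y := Gs)).
elim: w => [|x w [v [wv nf_v]]].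
  by exists [::]; split=> //; exact: rst_refl.
have xwv: comm_eq G2t (x :: w) (x :: v).
  by have := comm_eq_context [:: x] [::] wv; rewrite /= !cats0.
case: x xwv => xwv; [by exists (Gs :: v) | by exists (Gt :: v) |].
have [v' vv' nf_v'] := insert_u v nf_v.
by exists v'; split=> //; exact: comm_eq_trans xwv vv'.
Qed.

Lemma tst_forbidden : forbidden G2t [:: Gt; Gs; Gt].
Proof.
exact: (@braid_forbidden _ _ G2t_diag G2t_sym Gt Gs _ [:: Gs; Gt; Gs]).
Qed.

Lemma sts_forbidden : forbidden G2t [:: Gs; Gt; Gs].
Proof.
exact: (@braid_forbidden _ _ G2t_diag G2t_sym Gs Gt _ [:: Gt; Gs; Gt]).
Qed.

Lemma tututu_forbidden : forbidden G2t [:: Gt; Gu; Gt; Gu; Gt; Gu].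
Proof.
exact: (@braid_forbidden _ _ G2t_diag G2t_sym Gt Gu _
          [:: Gu; Gt; Gu; Gt; Gu; Gt]).
Qed.

Lemma ututut_forbidden : forbidden G2t [:: Gu; Gt; Gu; Gt; Gu; Gt].
Proof.
exact: (@braid_forbidden _ _ G2t_diag G2t_sym Gu Gt _
          [:: Gt; Gu; Gt; Gu; Gt; Gu]).
Qed.

Lemma su_us : comm_eq G2t [:: Gs; Gu] [:: Gu; Gs].
Proof. by apply: rst_step; exact: (CommStep [::] [::] (x := Gs) (y := Gu)). Qed.

Lemma suts_forbidden : forbidden G2t [:: Gs; Gu; Gt; Gs].
Proof.
apply: (forbidden_comm_eq G2t_diag (comm_eq_context [::] [:: Gt; Gs] su_us)).
exact: forbidden_infix sts_forbidden.
Qed.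

Lemma tututsu_forbidden : forbidden G2t [:: Gt; Gu; Gt; Gu; Gt; Gs; Gu].
Proof.
pose p := [:: Gt; Gu; Gt; Gu; Gt].
apply: (forbidden_comm_eq G2t_diag (comm_eq_context p [::] su_us)).
exact: forbidden_infix tututu_forbidden.
Qed.

(** * Gaps between consecutive letters t *)

(** The closing [t] is part of the gap, so that [t] followed by the
    concatenation of the gaps is a word that starts and ends with [t]. *)
Definition gap (with_s : bool) : seq gen :=
  if with_s then [:: Gs; Gu; Gt] else [:: Gu; Gt].

Definition gaps (bs : seq bool) : seq gen := flatten (map gap bs).

Lemma gaps_cat bs cs : gaps (bs ++ cs) = gaps bs ++ gaps cs.
Proof. by rewrite /gaps map_cat flatten_cat. Qed.

Lemma infix_gaps bs cs : infix bs cs -> infix (gaps bs) (gaps cs).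
Proof.
by case/infixP=> [x [y ->]]; rewrite !gaps_cat infix_infix.
Qed.

Lemma gaps_belast bs : exists z, Gt :: gaps bs = rcons z Gt.
Proof.
elim/last_ind: bs => [|bs b _]; first by exists [::].
rewrite -cats1 gaps_cat; case: b.
  by exists (Gt :: gaps bs ++ [:: Gs; Gu]); rewrite rcons_cons rcons_cat.
by exists (Gt :: gaps bs ++ [:: Gu]); rewrite rcons_cons rcons_cat.
Qed.

Lemma count_gaps bs : count_mem Gt (gaps bs) = size bs.
Proof.
elim: bs => // b bs IHbs; rewrite -[b :: bs]cat1s gaps_cat count_cat IHbs.
by case: b.
Qed.

(** After a letter [t], the normal form and the factors [ss], [tst], [uu], [tt]
    leave only the continuations [sut] and [ut]. *)
Lemma gaps_parse r :
    ~ forbidden G2t (Gt :: r) -> ~~ infix [:: Gu; Gs] (Gt :: r) ->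
    last Gt r = Gt ->
  exists bs, r = gaps bs.
Proof.
have [n] := ubnP (size r); elim: n r => // n IHn r.
have sq := square_forbidden G2t_diag.
have absurd p f q : forbidden G2t f -> ~ forbidden G2t (p ++ f ++ q) -> False.
  by move=> bad_f; apply; apply: forbidden_infix bad_f; exact: infix_infix.
have us p q : ~~ infix [:: Gu; Gs] (p ++ [:: Gu; Gs] ++ q) -> False.
  by rewrite infix_infix.
have next p r' : ~ forbidden G2t (p ++ Gt :: r') -> ~ forbidden G2t (Gt :: r').
  by move=> good bad; apply/good/forbidden_infix/bad; exact: suffix_infix.
case: r => [|[] r]; first by exists [::].
- case: r => [|[] r] //=.
  + by move=> _ /(absurd [:: Gt] _ r (sq Gs)).
  + by move=> _ /(absurd [::] _ r tst_forbidden).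
  case: r => [|[] r] //=.
  + by move=> _ _ /(us [:: Gt; Gs] r).
  + move=> lt_r /(next [:: Gt; Gs; Gu]) good nf last_r.
    have [|bs ->] := IHn r _ good nf last_r; first by lia.
    by exists (true :: bs).
  + by move=> _ /(absurd [:: Gt; Gs] _ r (sq Gu)).
- by move=> _ /(absurd [::] _ r (sq Gt)).
case: r => [|[] r] //=.
- by move=> _ _ /(us [:: Gt] r).
- move=> lt_r /(next [:: Gt; Gu]) good nf last_r.
  have [|bs ->] := IHn r _ good nf last_r; first by lia.
  by exists (false :: bs).
by move=> _ /(absurd [:: Gt] _ r (sq Gu)).
Qed.

(** Two gaps [su] always contain a forbidden factor, but two gaps [u] give only
    [tutut], one letter short of a braid: the missing letter comes from a third
    gap, before or after them. *)
Lemma repeated_gap_forbidden b bs :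
  2 < size bs -> infix [:: b; b] bs -> forbidden G2t (Gt :: gaps bs).
Proof.
have lift f cs : infix f (gaps cs) -> infix cs bs -> infix f (Gt :: gaps bs).
  move=> f_cs cs_bs; apply: infix_trans (infix_cons _ _).
  exact: infix_trans f_cs (infix_gaps cs_bs).
case: b => [_ rep | big_bs rep].
  by apply: forbidden_infix suts_forbidden; apply: lift rep.
have [x [y def_bs]] := infixP rep.
case/lastP: x def_bs => [|x a] def_bs.
  (* No gap before the repetition: there is one after it. *)
  case: y def_bs big_bs => [|[] y] -> //= _.
    exact: forbidden_infix (prefix_infix _ (Gt :: gaps y)) tututsu_forbidden.
  exact: forbidden_infix (prefix_infix _ (Gt :: gaps y)) tututu_forbidden.
(* The [u] of the preceding gap, with or without [s], starts the braid. *)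
apply: forbidden_infix ututut_forbidden; apply: (lift _ [:: a; false; false]).
  by case: a {def_bs}.
by rewrite def_bs cat_rcons; exact: (infix_infix x [:: a; false; false] y).
Qed.

(** * Alternating gaps and powers of tsutu *)

Lemma word_powSr (T : Type) (v : seq T) N : word_pow v N.+1 = word_pow v N ++ v.
Proof. by rewrite /word_pow -addn1 nseqD flatten_cat /= cats0. Qed.

Lemma word_pow_shift (T : Type) (x : T) v N :
  x :: word_pow (rcons v x) N = rcons (word_pow (x :: v) N) x.
Proof.
elim: N => [|N IHN] //.
rewrite -[word_pow (rcons v x) _]/(rcons v x ++ word_pow (rcons v x) N).
rewrite -[word_pow (x :: v) _]/((x :: v) ++ word_pow (x :: v) N).
by rewrite cat_rcons IHN rcons_cat.
Qed.


(** Periodicity: a power of a rotated word, preceded by the letter that the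
    rotation moved, is again a piece of a power of the original word. *)
Lemma prefix_word_pow (T : eqType) (x : T) v N :
  prefix (x :: word_pow (rcons v x) N) (word_pow (x :: v) N.+1).
Proof. by rewrite word_pow_shift word_powSr -cat_rcons prefix_prefix. Qed.

Lemma alternating_prefix b bs :
    (forall c, ~~ infix [:: c; c] (b :: bs)) ->
  exists N, prefix (b :: bs) (word_pow [:: b; ~~ b] N).
Proof.
elim: bs b => [|c bs IHbs] b alt; first by exists 1; rewrite /= eqxx.
have def_c: c = ~~ b.
  have: c != b.
    by apply: contraNneq (alt b) => ->; exact: (prefix_infix [:: b; b] bs).
  by case: b c {alt IHbs} => [] [].
have [d|N] := IHbs c.
  by apply: contra (alt d) => dd; apply: infix_trans dd (infix_cons _ _).
rewrite def_c negbK => pre_bs; exists N.+1.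
apply: prefix_trans (prefix_word_pow b [:: ~~ b] N).
by rewrite prefix_cons eqxx.
Qed.

Lemma alternating_infix bs :
    (forall c, ~~ infix [:: c; c] bs) ->
  exists N, infix bs (word_pow [:: true; false] N).
Proof.
case: bs => [|b bs] alt; first by exists 0.
have [N pre] := alternating_prefix alt; case: b {alt} pre => pre.
  by exists N; apply: prefixW.
exists N.+1; apply: infix_prefix_trans (prefix_word_pow true [:: false] N).
exact: infix_trans (prefixW pre) (infix_cons _ _).
Qed.

Lemma gaps_word_pow N :
  gaps (word_pow [:: true; false] N) = word_pow [:: Gs; Gu; Gt; Gu; Gt] N.
Proof.
elim: N => // N IHN.
rewrite -[word_pow _ N.+1]/([:: true; false] ++ word_pow [:: true; false] N).
by rewrite gaps_cat IHN.
Qed.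

Lemma alternating_gaps_infix bs :
    (forall c, ~~ infix [:: c; c] bs) ->
  exists2 N, 0 < N & infix (Gt :: gaps bs) (word_pow [:: Gt; Gs; Gu; Gt; Gu] N).
Proof.
case/alternating_infix=> N /infixP[x [y def_pow]]; exists N.+1 => //.
apply: infix_prefix_trans (prefix_word_pow Gt [:: Gs; Gu; Gt; Gu] N).
(* The [t] before the first gap of [bs] is the last letter of what precedes. *)
rewrite -gaps_word_pow def_pow 2!gaps_cat -cat_cons.
have [z ->] := gaps_belast x.
by rewrite cat_rcons -cat_cons infix_infix.
Qed.

(** * Cutting a word at its extremal letters t *)

Lemma first_occurrence (S : eqType) (c : S) w :
  c \in w -> exists p q, c \notin p /\ w = p ++ c :: q.
Proof.
elim: w => //= x w IHw; rewrite inE; have [->|x_c /= /IHw] := eqVneq c x.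
  by exists [::], w.
by case=> p [q [p_c ->]]; exists (x :: p), q; rewrite inE negb_or x_c.
Qed.

Lemma cut_extremal (S : eqType) (c : S) w : c \in w ->
  exists p r q, [/\ c \notin p, c \notin q, last c r = c & w = p ++ (c :: r) ++ q].
Proof.
case/first_occurrence=> p [z [p_c ->]].
have [z_c | z_c] := boolP (c \in z); last by exists p, [::], z.
have [|q' [r' [q_c]]] := @first_occurrence _ c (rev z); first by rewrite mem_rev.
move/(congr1 rev); rewrite revK rev_cat rev_cons => ->.
exists p, (rcons (rev r') c), (rev q'); rewrite mem_rev last_rcons; split=> //.
Qed.

Lemma occurrence_bounds (S : eqType) (c : S) p v q k :
    c \notin p -> c \notin q -> k < size (p ++ v ++ q) ->
    nth c (p ++ v ++ q) k = c ->
  size p <= k < size p + size v.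
Proof.
move=> p_c q_c; rewrite !size_cat !nth_cat => lt_k.
case: ltnP => [lt_kp | le_pk].
  by move=> k_c; case/negP: p_c; rewrite -k_c mem_nth.
case: ltnP => [lt_kv | le_vk] k_c; first by lia.
by case/negP: q_c; rewrite -k_c mem_nth //; lia.
Qed.

Lemma fc_word_cut w :
    fc_word G2t w -> ~~ infix [:: Gu; Gs] w -> 4 < count_mem Gt w ->
  exists p r q N,
    [/\ w = p ++ (Gt :: r) ++ q, Gt \notin p, Gt \notin q, last Gt r = Gt &
        0 < N /\ infix (Gt :: r) (word_pow [:: Gt; Gs; Gu; Gt; Gu] N)].
Proof.
move=> fc_w nf_w count_w; have w_t: Gt \in w.
  by rewrite -has_pred1 has_count (leq_trans _ count_w).
have [p [r [q [p_t q_t last_r def_w]]]] := cut_extremal w_t.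
have good: ~ forbidden G2t (Gt :: r) by move/(_ p q); rewrite -def_w.
have nf_r: ~~ infix [:: Gu; Gs] (Gt :: r).
  by apply: contra nf_w => us; rewrite def_w infix_catl // infix_catr.
have [bs def_r] := gaps_parse good nf_r last_r.
have [|N N_gt0 inf] := @alternating_gaps_infix bs; last first.
  by exists p, r, q, N; split=> //; rewrite def_r.
move=> c; apply/negP=> rep; apply: good; rewrite def_r.
apply: repeated_gap_forbidden rep; move: count_w.
rewrite def_w !count_cat (count_memPn p_t) (count_memPn q_t) def_r /=.
by rewrite count_gaps; lia.
Qed.

(** Every letter is equal or adjacent to [t] in the Coxeter graph, so any two
    positions one of which carries [t] are joined by an edge. *)
Lemma t_comparable w (i j : heap G2t w) :
    heap_label G2t w i = Gt \/ heap_label G2t w j = Gt ->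
  (i <= j)%O = (i <= j).
Proof.
move=> t_ij; apply/idP/idP; first exact: heap_le_leq.
rewrite leq_eqVlt => /predU1P[/val_inj -> | lt_ij]; first exact: heap_le_refl.
apply: connect1; rewrite /heap_edge lt_ij /cox_adj /=.
by case: t_ij => ->; case: (heap_label _ _ _).
Qed.

Theorem lemma5p2 (d : Order.disp_t) (H : finPOrderType d) (lab : H -> gen)
    (Hfc : fc_heap G2t lab) (Ht : 4 < #|[set x : H | lab x == Gt]|) :
  exists a b : H,
    [/\ least_labeled a lab Gt, greatest_labeled b lab Gt
      & exists (N : nat) (v : seq gen),
          [/\ 0 < N, infix v (word_pow [:: Gt; Gs; Gu; Gt; Gu] N)
            & lposet_iso (interval_label (a := a) (b := b) lab)
                         (heap_label G2t v)]].
Proof.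
case: Hfc => w0 [red_w0 fc_w0 iso_w0].
have [w [w0w nf_w]] := su_normal_form w0.
have fc_w: fc_word G2t w.
  by apply: fc_word_comm_eq (comm_eq_sym w0w) _; first exact: G2t_diag.
have iso_w: lposet_iso lab (heap_label G2t w).
  apply: lposet_iso_trans iso_w0 _.
  by apply: comm_eq_heap_iso w0w; [exact: G2t_diag | exact: G2t_sym].
have count_w: 4 < count_mem Gt w.
  by rewrite -(card_heap_label G2t) -(lposet_iso_card _ iso_w).
have [p [r [q [N [def_w p_t q_t last_r [N_gt0 inf_r]]]]]] :=
  fc_word_cut fc_w nf_w count_w.
move: iso_w; rewrite {}def_w; set v := Gt :: r in inf_r *.
case/lposet_iso_sym=> g [[f gK fK] g_mono g_lab].
pose shift := @heap_shift _ G2t p v q.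
pose i0 : heap G2t v := Ordinal (ltn0Sn (size r)).
pose i1 : heap G2t v := Ordinal (ltnSn (size r)).
have i1_lab: heap_label G2t v i1 = Gt.
  by rewrite (heap_label_nth Gt) -[RHS]last_r (last_nth Gt).
have t_in_v (k : heap G2t (p ++ v ++ q)) :
    heap_label G2t _ k = Gt -> size p <= k < size p + size v.
  by rewrite (heap_label_nth Gt); exact: occurrence_bounds.
have f_lab x : heap_label G2t _ (f x) = lab x by rewrite -g_lab fK.
exists (g (shift i0)), (g (shift i1)); split.
- split=> [|x x_t]; first by rewrite g_lab heap_label_shift.
  rewrite -[x]fK g_mono t_comparable; last by left; rewrite heap_label_shift.
  by have := t_in_v (f x); rewrite f_lab /= addn0 => /(_ x_t)/andP[].
- split=> [|x x_t]; first by rewrite g_lab heap_label_shift.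
  rewrite -[x]fK g_mono t_comparable; last by right; rewrite heap_label_shift.
  by have := t_in_v (f x); rewrite f_lab /= => /(_ x_t); lia.
exists N, v; split=> //.
apply: (lposet_iso_interval (g := g \o shift)) => [i j|i|y] /=.
- by rewrite g_mono heap_shift_mono.
- by rewrite g_lab heap_label_shift.
rewrite -[y]fK !g_mono !t_comparable; first last.
- by left; rewrite heap_label_shift.
- by right; rewrite heap_label_shift.
split=> [/andP[le_0 le_1] | [i /(can_inj gK) ->]].
  have [||i ->] := @heap_shift_onto _ G2t p v q (f y); last by exists i.
  - by move: le_0; rewrite /= addn0.
  - by move: le_1 => /=; lia.
by rewrite /= !leq_add2l leq0n -ltnS ltn_ord.
Qed.
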